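(* Let $V$ be an $\mathcal F$-representation with polynomially bounded dimension: $\dim V[n]\le\psi(n)$ for all $n\ge 0$, where $\psi$ is a polynomial of degree $d$. Then $V$ is a quotient of a finite direct sum of tensor powers $\otimes^k$ with $k\le d+1$. In fact, $V$ is a quotient of a finite direct sum whose summands are tensor powers $\otimes^k$ with $k\le d$ and copies of $\Lambda^{d+1}$.
   Context: $\mathcal F$ is the category with objects the finite sets $[k]=\{1,\dots,k\}$, $k\ge 0$, and all functions as morphisms. $\mathcal V$ is the category of finite-dimensional $\mathbb Q$-vector spaces. An $\mathcal F$-representation is a functor $V:\mathcal F\to\mathcal V$; morphisms are natural transformations and quotients are objectwise. For $k\ge0$, $\otimes^k:\mathcal F\to\mathcal V$ is the functor sending $X$ to the free $\mathbb Q$-vector space on the set of functions $[k]\to X$ (with $\mathcal F$ acting by postcomposition); equivalently $\otimes^kX\cong(\mathbb QX)^{\otimes k}$. $\Lambda^k$ is the direct summand of $\otimes^k$ that is the image of precomposition with $\varepsilon_k=\frac1{k!}\sum_{\sigma\in\mathcal S_k}\operatorname{sign}(\sigma)\,\sigma$; equivalently $\Lambda^kX$ is the $k$-th exterior power of the free vector space $\mathbb QX$. *)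

(* Defs.v *)
From HB Require Import structures.
From mathcomp Require Import all_boot all_order all_fingroup all_algebra.

Set Implicit Arguments.
Unset Strict Implicit.
Unset Printing Implicit Defensive.

Import GRing.Theory.
Local Open Scope ring_scope.

Definition fcomp (A B C : finType) (g : {ffun B -> C}) (f : {ffun A -> B}) :
  {ffun A -> C} := [ffun x => g (f x)].

Definition fid (A : finType) : {ffun A -> A} := [ffun x => x].

(* The object [n] of F is encoded by n : nat, its underlying set by 'I_n. *)
Record frep := FRep {
  frep_obj :> nat -> vectType rat;
  frep_map : forall m n : nat,
    {ffun 'I_m -> 'I_n} -> 'Hom(frep_obj m, frep_obj n);
  frep_map_id : forall n : nat, frep_map (fid 'I_n) = \1%VF;
  frep_map_comp : forall (l m n : nat)
      (g : {ffun 'I_m -> 'I_n}) (f : {ffun 'I_l -> 'I_m}),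
    frep_map (fcomp g f) = (frep_map g \o frep_map f)%VF
}.

Record nat_trans (V W : frep) := NatTrans {
  nt_app :> forall n : nat, 'Hom(V n, W n);
  nt_natural : forall (m n : nat) (f : {ffun 'I_m -> 'I_n}),
    (nt_app n \o frep_map V f)%VF = (frep_map W f \o nt_app m)%VF
}.

Definition is_quotient_of (V W : frep) : Prop :=
  exists eta : nat_trans W V, forall n : nat, limg (eta n) = fullv.

Section Zero.

Let zero_obj (n : nat) : vectType rat := 'rV[rat]_0.

Let zero_map (m n : nat) (f : {ffun 'I_m -> 'I_n}) :
  'Hom(zero_obj m, zero_obj n) := 0.

Fact zero_map_id n : zero_map (fid 'I_n) = \1%VF.
Proof. by apply/lfunP => v; apply/rowP => -[]. Qed.

Fact zero_map_comp (l m n : nat)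
    (g : {ffun 'I_m -> 'I_n}) (f : {ffun 'I_l -> 'I_m}) :
  zero_map (fcomp g f) = (zero_map g \o zero_map f)%VF.
Proof. by apply/lfunP => v; apply/rowP => -[]. Qed.

Definition frep_zero : frep := FRep zero_map_id zero_map_comp.

End Zero.

Section DirectSum.

Variables V W : frep.

Let sum_obj (n : nat) : vectType rat := (V n * W n)%type.

Definition sum_fun (m n : nat) (f : {ffun 'I_m -> 'I_n}) (u : V m * W m) :
  V n * W n := (frep_map V f u.1, frep_map W f u.2).

Fact sum_fun_linear (m n : nat) (f : {ffun 'I_m -> 'I_n}) :
  linear (sum_fun f).
Proof. by move=> a u v; rewrite /sum_fun /= !linearP. Qed.

HB.instance Definition _ (m n : nat) (f : {ffun 'I_m -> 'I_n}) :=
  GRing.isLinear.Build rat (V m * W m)%type (V n * W n)%type _ (sum_fun f)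
    (sum_fun_linear f).

Let sum_map (m n : nat) (f : {ffun 'I_m -> 'I_n}) :
  'Hom(sum_obj m, sum_obj n) := linfun (sum_fun f).

Fact sum_map_id n : sum_map (fid 'I_n) = \1%VF.
Proof.
by apply/lfunP => -[u v]; rewrite !lfunE /= /sum_fun !frep_map_id !lfunE.
Qed.

Fact sum_map_comp (l m n : nat)
    (g : {ffun 'I_m -> 'I_n}) (f : {ffun 'I_l -> 'I_m}) :
  sum_map (fcomp g f) = (sum_map g \o sum_map f)%VF.
Proof.
apply/lfunP => -[u v]; rewrite comp_lfunE !lfunE /= /sum_fun /=.
by rewrite !frep_map_comp !comp_lfunE.
Qed.

Definition frep_sum : frep := FRep sum_map_id sum_map_comp.

End DirectSum.

Definition frep_bigsum (Vs : seq frep) : frep := foldr frep_sum frep_zero Vs.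

Section Image.

Variables (V W : frep) (eta : nat_trans V W).

Let im_obj (n : nat) : vectType rat := subvs_of (limg (eta n)).

Fact im_closed (m n : nat) (f : {ffun 'I_m -> 'I_n}) (w : W m) :
  w \in limg (eta m) -> frep_map W f w \in limg (eta n).
Proof.
case/memv_imgP => v _ ->.
have := nt_natural eta f => /lfunP/(_ v); rewrite !comp_lfunE => <-.
exact: memv_img (memvf _).
Qed.

(* By im_closed the projection vsproj acts here as a mere corestriction. *)
Let im_map (m n : nat) (f : {ffun 'I_m -> 'I_n}) : 'Hom(im_obj m, im_obj n) :=
  (linfun (vsproj (limg (eta n))) \o frep_map W f
     \o linfun (@vsval rat (W m) (limg (eta m))))%VF.

Fact im_mapE (m n : nat) (f : {ffun 'I_m -> 'I_n}) (u : im_obj m) :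
  vsval (im_map f u) = frep_map W f (vsval u).
Proof.
by rewrite !comp_lfunE !lfunE /= vsprojK // im_closed // subvsP.
Qed.

Fact im_map_id n : im_map (fid 'I_n) = \1%VF.
Proof.
apply/lfunP => u; apply: val_inj.
by rewrite [LHS]im_mapE frep_map_id !id_lfunE.
Qed.

Fact im_map_comp (l m n : nat)
    (g : {ffun 'I_m -> 'I_n}) (f : {ffun 'I_l -> 'I_m}) :
  im_map (fcomp g f) = (im_map g \o im_map f)%VF.
Proof.
apply/lfunP => u; apply: val_inj.
rewrite [LHS]im_mapE comp_lfunE [RHS]im_mapE im_mapE.
by rewrite frep_map_comp comp_lfunE.
Qed.

Definition frep_image : frep := FRep im_map_id im_map_comp.

End Image.

Definition freeQ (T : finType) : vectType rat := {ffun T -> rat^o}.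

Definition freeQ_base (T : finType) (x : T) : freeQ T :=
  [ffun y => (y == x)%:R].

Definition freeQ_fun (T U : finType) (f : T -> U) (v : freeQ T) : freeQ U :=
  \sum_(x : T) (v x : rat) *: freeQ_base (f x).

Fact freeQ_fun_linear (T U : finType) (f : T -> U) : linear (freeQ_fun f).
Proof.
move=> a u v; rewrite /freeQ_fun scaler_sumr -big_split /=.
by apply: eq_bigr => x _; rewrite !ffunE scalerDl scalerA.
Qed.

HB.instance Definition _ (T U : finType) (f : T -> U) :=
  GRing.isLinear.Build rat (freeQ T) (freeQ U) _ (freeQ_fun f)
    (freeQ_fun_linear f).

Definition freeQ_map (T U : finType) (f : T -> U) : 'Hom(freeQ T, freeQ U) :=
  linfun (freeQ_fun f).

Fact freeQ_map_base (T U : finType) (f : T -> U) (x : T) :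
  freeQ_map f (freeQ_base x) = freeQ_base (f x).
Proof.
rewrite lfunE /= /freeQ_fun (bigD1 x) //= big1 => [|y yx].
  by rewrite ffunE eqxx scale1r addr0.
by rewrite ffunE (negbTE yx) scale0r.
Qed.

Fact freeQ_decomp (T : finType) (v : freeQ T) :
  v = \sum_(x : T) (v x : rat) *: freeQ_base x.
Proof.
apply/ffunP => y; rewrite sum_ffunE (bigD1 y) //= big1 => [|x xy].
  by rewrite !ffunE eqxx addr0 [RHS]mulr1.
by rewrite !ffunE eq_sym (negbTE xy) [LHS]mulr0.
Qed.

Fact freeQ_ext (T : finType) (vT : vectType rat) (p q : 'Hom(freeQ T, vT)) :
  (forall x, p (freeQ_base x) = q (freeQ_base x)) -> p = q.
Proof.
move=> pq; apply/lfunP => v; rewrite (freeQ_decomp v) !linear_sum /=.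
by apply: eq_bigr => x _; rewrite !linearZ /= pq.
Qed.

Section Tensor.

Variable k : nat.

Let tens_obj (n : nat) : vectType rat := freeQ {ffun 'I_k -> 'I_n}.

Let tens_map (m n : nat) (f : {ffun 'I_m -> 'I_n}) :
  'Hom(tens_obj m, tens_obj n) :=
  freeQ_map (fun h : {ffun 'I_k -> 'I_m} => fcomp f h).

Fact tens_map_id n : tens_map (fid 'I_n) = \1%VF.
Proof.
apply: freeQ_ext => h; rewrite freeQ_map_base id_lfunE; congr freeQ_base.
by apply/ffunP => i; rewrite !ffunE.
Qed.

Fact tens_map_comp (l m n : nat)
    (g : {ffun 'I_m -> 'I_n}) (f : {ffun 'I_l -> 'I_m}) :
  tens_map (fcomp g f) = (tens_map g \o tens_map f)%VF.
Proof.
apply: freeQ_ext => h; rewrite comp_lfunE !freeQ_map_base; congr freeQ_base.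
by apply/ffunP => i; rewrite !ffunE.
Qed.

Definition tens : frep := FRep tens_map_id tens_map_comp.

Definition tens_precomp (s : 'S_k) (n : nat) : 'Hom(tens n, tens n) :=
  freeQ_map (fun h : {ffun 'I_k -> 'I_n} => [ffun i => h (s i)]).

Let alt_app (n : nat) : 'Hom(tens n, tens n) :=
  (k`!%:R)^-1 *: \sum_(s : 'S_k) (-1) ^+ s *: tens_precomp s n.

Fact alt_natural (m n : nat) (f : {ffun 'I_m -> 'I_n}) :
  (alt_app n \o frep_map tens f)%VF = (frep_map tens f \o alt_app m)%VF.
Proof.
apply: freeQ_ext => h; rewrite !comp_lfunE !scale_lfunE !sum_lfunE.
rewrite [RHS]linearZ /=; congr (_ *: _); rewrite [RHS]linear_sum /=.
apply: eq_bigr => s _.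
rewrite !scale_lfunE [RHS]linearZ /= !freeQ_map_base; congr (_ *: freeQ_base _).
by apply/ffunP => i; rewrite !ffunE.
Qed.

(* Precomposition with the antisymmetrizer
   (1 / k!) \sum_(s in 'S_k) sign(s) s, as an endomorphism of tens. *)
Definition alt : nat_trans tens tens := NatTrans alt_natural.

Definition ext_power : frep := frep_image alt.

End Tensor.

(* Main.v *)
From HB Require Import structures.
Require Import Defs.
From mathcomp Require Import all_boot all_order all_fingroup all_algebra.
Local Open Scope ring_scope.

Set Implicit Arguments.
Unset Strict Implicit.
Unset Printing Implicit Defensive.
Import Order.TTheory GRing.Theory Num.Theory.

(** The theorem holds because an F-representation that is not generated as
    claimed must grow too fast.  Fix a vector v in V[m], a set D of positions
    in [m], and a function jump : [m] -> [m].  Write h_P for the self-map of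
    [m] that applies jump at the positions in P and is the identity elsewhere,
    and let
<<
      z = \sum_(P \subset D) (-1)^|P| V(h_P) v.
>>
    If z is nonzero, then dim V[mN] >= N^|D| for every N > 0.  Indeed, view
    [mN] as m blocks of size N.  Choosing a point x_i in the i-th block, for i
    in D, and the first point of the other blocks, gives a section F_x of the
    projection onto [m].  The signed combination over P of the maps that send
    each block i to i, except that the point y_i is sent to jump(i) when i is
    in P, carries V(F_y) v to z.  It kills V(F_x) v for x <> y, since moving or
    not moving a position where x and y differ has no effect but a change of
    sign.  So the N^|D| vectors V(F_x) v are linearly independent
    ([signed_moves_growth]).

    If dim V[n] is bounded by a polynomial of degree d, it follows that z = 0
    as soon as |D| > d.  Two choices of (D, jump) exploit this relation.

    - In degree m > d + 1, let D consist of all positions but the first, and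
      let jump be constant, equal to the first position.  Each h_P with P
      nonempty is not injective, hence factors through [m - 1], and h_P is the
      identity for P empty.  So v comes from V[m - 1] ([generated_step]).

    - In degree m = d + 1, let D be everything, and let jump send a to b and
      all other positions to a.  The only injective h_P are the identity and
      the transposition (a b), so v + (a b) v comes from V[d]
      ([tperm_anti]).  Hence, modulo what comes from V[d], the symmetric group
      acts on V[d + 1] through the sign, and v agrees with its
      antisymmetrization ([antisymmetrize_sub]).

    Consequently V is generated by the V[k] with k <= d and the image of the
    antisymmetrizer on V[d + 1] ([generation]).  By the Yoneda lemma, a vector
    of V[k] is the same as a morphism from the k-th tensor power to V, and
    bases of these finitely many spaces give the required surjections.  For the
    first claim, all of V[d + 1] is generated by tensor powers of degree at
    most d + 1. *)

(** * Two linear-algebra tools and a growth estimate *)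

(** The lower bound N^(d+1) for dim V[mN] is to be compared with the
    polynomial upper bound at mN, whose leading factor m^d is a constant. *)
Lemma poly_lt_power (R : archiRealFieldType) (p : {poly R}) (d m : nat) :
  (0 < m)%N -> (size p <= d.+1)%N ->
  exists2 N : nat, (0 < N)%N & p.[(m * N)%:R] < N%:R ^+ d.+1.
Proof.
move=> m0 szp; pose C := \sum_(i < size p) `|p`_i|.
have C0 : 0 <= C by apply: sumr_ge0.
pose N := Num.bound (C * m%:R ^+ d).
have Cm0 : 0 <= C * m%:R ^+ d by rewrite mulr_ge0 // exprn_ge0.
have ltN : C * m%:R ^+ d < N%:R := archi_boundP Cm0.
have N0 : (0 < N)%N by rewrite -(ltr0n R) (le_lt_trans Cm0).
exists N => //; apply: (@le_lt_trans _ _ (C * (m * N)%:R ^+ d)); last first.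
  rewrite natrM exprMn mulrA exprS ltr_pM2r // exprn_gt0 // ltr0n //.
rewrite horner_coef mulr_suml; apply: ler_sum => i _.
apply: (le_trans (ler_norm _)); rewrite normrM ler_wpM2l // ger0_norm.
  by rewrite ler_weXn2l ?ler1n ?muln_gt0 ?m0 // -ltnS (leq_trans _ szp).
by rewrite exprn_ge0.
Qed.

(** The maps L y act as dual functionals up to the nonzero vector z, so the
    vectors b x are linearly independent.  Working with maps into B instead of
    scalar functionals avoids choosing a functional that is nonzero on z. *)
Lemma card_dual_family (K : fieldType) (A B : vectType K) (T : finType)
    (S : {pred T}) (b : T -> A) (L : T -> 'Hom(A, B)) (z : B) :
  z != 0 ->
  {in S &, forall x y, L y (b x) = if x == y then z else 0} ->
  (#|S| <= \dim (fullv : {vspace A}))%N.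
Proof.
move=> z0 Lb; rewrite cardE -(size_map b).
suff /eqP <- : free (map b (enum S)) by apply: dimvS; exact: subvf.
rewrite -[map b _]/(tval (in_tuple (map b (enum S)))); apply/freeP => k sum0 i.
have szi j : (j < size (map b (enum S)))%N -> (j < size (enum S))%N.
  by rewrite size_map.
have [x0 x0S] : exists x0, x0 \in S.
  have := szi _ (ltn_ord i); rewrite -cardE => /(leq_ltn_trans (leq0n _)).
  by case/card_gt0P => x; exists x.
have nthS j : (j < size (map b (enum S)))%N -> nth x0 (enum S) j \in S.
  by move=> /szi ltj; rewrite -mem_enum mem_nth.
have := congr1 (L (nth x0 (enum S) i)) sum0.
rewrite linear0 linear_sum (bigD1 i) //= big1 => [|j ji]; rewrite linearZ /=.
  rewrite (nth_map x0) ?szi // Lb ?nthS // eqxx addr0.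
  by move/eqP; rewrite scaler_eq0 (negbTE z0) orbF => /eqP.
rewrite (nth_map x0) ?szi // Lb ?nthS // nth_uniq ?enum_uniq ?szi //.
by rewrite (inj_eq val_inj) (negbTE ji) scaler0.
Qed.

(** Toggling the membership of i0 is an involution on the subsets of D that
    changes the sign and preserves phi, so the terms cancel in pairs. *)
Lemma signed_sum_subsets_eq0 (K : pzRingType) (A : lmodType K) (I : finType)
    (D : {set I}) (i0 : I) (phi : {set I} -> A) :
  i0 \in D -> (forall P, phi (i0 |: P) = phi (P :\ i0)) ->
  \sum_(P : {set I} | P \subset D) (-1) ^+ #|P| *: phi P = 0.
Proof.
move=> i0D phi_toggle; rewrite (bigID (fun P : {set I} => i0 \in P)) /=.
rewrite (reindex_onto (fun P => i0 |: P) (fun P => P :\ i0)) /=; last first.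
  by move=> P /andP[_ i0P]; rewrite setD1K.
rewrite [X in _ + X](eq_bigl
  (fun P : {set I} => (P \subset D) && (i0 \notin P))) //.
rewrite [X in X + _](eq_bigl
  (fun P : {set I} => (P \subset D) && (i0 \notin P))) => [|P]; last first.
  rewrite setU11 andbT subUset sub1set i0D /=; congr andb.
  by apply/eqP/idP => [<-|/setU1K //]; rewrite !inE eqxx.
rewrite -big_split /= big1 // => P /andP[_ i0P].
rewrite cardsU1 i0P exprS mulN1r scaleNr phi_toggle.
by rewrite (setDidPl _) ?addNr // disjoint_sym disjoints1.
Qed.

(** * Independent vectors from signed sums of self-maps *)

Definition move_on (m : nat) (jump : 'I_m -> 'I_m) (P : {set 'I_m}) :
  {ffun 'I_m -> 'I_m} := [ffun i => if i \in P then jump i else i].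

Definition signed_moves (V : frep) (m : nat) (D : {set 'I_m})
    (jump : 'I_m -> 'I_m) : 'End(V m) :=
  \sum_(P : {set 'I_m} | P \subset D)
    (-1) ^+ #|P| *: frep_map V (move_on jump P).

Section Growth.

Variables (V : frep) (m N : nat) (jump : 'I_m -> 'I_m).

(** The set with mN elements is taken as the enumeration of 'I_m * 'I_N, so
    that its m blocks of size N are the fibers of the first projection. *)
Definition section_map (x : {ffun 'I_m -> 'I_N}) :
  {ffun 'I_m -> 'I_#|{: 'I_m * 'I_N}|} := [ffun i => enum_rank (i, x i)].

Definition test_map (y : {ffun 'I_m -> 'I_N}) (P : {set 'I_m}) :
    {ffun 'I_#|{: 'I_m * 'I_N}| -> 'I_m} :=
  [ffun q => let: (i, j) := enum_val q in
    if (i \in P) && (j == y i) then jump i else i].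

(** The point of block i chosen by x is moved only if y chooses it too: this
    is why the test against y only sees the positions where x and y agree. *)
Lemma test_map_section x y P :
  fcomp (test_map y P) (section_map x)
    = move_on jump (P :&: [set i | x i == y i]).
Proof. by apply/ffunP => i; rewrite !ffunE enum_rankK !inE. Qed.

End Growth.

(** The sections indexed by the choices of points in the blocks of D give
    independent vectors.  The choices outside D are frozen to ord0, which makes
    the choices a set of partial functions with support in D. *)
Lemma signed_moves_growth (V : frep) (m N : nat) (D : {set 'I_m})
    (jump : 'I_m -> 'I_m) (v : V m) :
  (0 < N)%N -> signed_moves V D jump v != 0 ->
  (N ^ #|D| <= \dim (fullv : {vspace V (m * N)%N}))%N.
Proof.
case: N => // N _ z0.
have -> : (m * N.+1)%N = #|{: 'I_m * 'I_N.+1}| by rewrite card_prod !card_ord.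
rewrite -[X in (X ^ _)%N]card_ord.
rewrite -[X in (X ^ _)%N](eq_card (_ : xpredT =i predT)) //.
rewrite -(card_pffun_on ord0 D predT).
apply: (@card_dual_family _ _ _ _ _
  (fun x => frep_map V (section_map x) v)
  (fun y => \sum_(P : {set 'I_m} | P \subset D)
     (-1) ^+ #|P| *: frep_map V (test_map jump y P)) _ z0).
move=> x y xS yS; rewrite sum_lfunE.
under eq_bigr => P _ do
  rewrite scale_lfunE -comp_lfunE -frep_map_comp test_map_section.
have [<-|neq_xy] := eqVneq x y.
  rewrite /signed_moves sum_lfunE; apply: eq_bigr => P _; rewrite scale_lfunE.
  congr (_ *: frep_map V (move_on jump _) v).
  by apply/setP => i; rewrite !inE eqxx andbT.
(* At a position i where x and y differ, the toggle of i is invisible. *)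
have [i neq_i] : exists i, x i != y i.
  by apply/existsP; apply: contraR neq_xy; rewrite negb_exists =>
    /forallP eq_xy; apply/eqP/ffunP => i; apply/eqP; rewrite -[_ == _]negbK.
apply: (@signed_sum_subsets_eq0 _ _ _ D i
  (fun P => frep_map V (move_on jump (P :&: [set i | x i == y i])) v)).
  have out (w : {ffun 'I_m -> 'I_N.+1}) :
      w \in pffun_on ord0 D predT -> i \notin D -> w i = ord0.
    by case/pffun_onP => /supportP supp _ iD; apply: supp.
  by apply: contraR neq_i => iD; rewrite !out.
move=> P; congr (frep_map V (move_on jump _) v); apply/setP => j; rewrite !inE.
by case: (eqVneq j i) => [->|//]; rewrite (negbTE neq_i) !andbF.
Qed.

(** * Relations forced by slow growth *)

(** The only consequence of a polynomial bound of degree d that the argument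
    uses; it makes sense without reference to the polynomial. *)
Definition slow_growth (V : frep) (d : nat) : Prop :=
  forall m : nat, (0 < m)%N -> exists2 N : nat, (0 < N)%N
    & (\dim (fullv : {vspace V (m * N)%N}) < N ^ d.+1)%N.

Definition stable (V : frep) (U : forall n, {vspace V n}) : Prop :=
  forall (m n : nat) (f : {ffun 'I_m -> 'I_n}) (v : V m),
    v \in U m -> frep_map V f v \in U n.

(** If h identifies a and b, then h factors as the collapse of b onto a,
    which lands in a set with m elements, followed by the restriction of h. *)
Lemma stable_noninjective (V : frep) (U : forall n, {vspace V n}) (m : nat)
    (h : {ffun 'I_m.+1 -> 'I_m.+1}) (v : V m.+1) (a b : 'I_m.+1) :
  stable U -> U m = fullv -> a != b -> h a = h b ->
  frep_map V h v \in U m.+1.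
Proof.
move=> stU Um neq_ab h_ab.
have [a' def_a'] : exists a', a = lift b a'.
  rewrite eq_sym in neq_ab.
  by have [a' def_a' _] := unlift_some neq_ab; exists a'.
pose g : {ffun 'I_m.+1 -> 'I_m} := [ffun i => odflt a' (unlift b i)].
have -> : h = fcomp [ffun j => h (lift b j)] g.
  apply/ffunP => i; rewrite !ffunE.
  by case: unliftP => [j ->|->] //=; rewrite -def_a'.
by rewrite frep_map_comp comp_lfunE; apply: stU; rewrite Um memvf.
Qed.

Section Bounded.

Variables (V : frep) (d : nat).

Hypothesis slow : slow_growth V d.

Lemma signed_moves_eq0 (m : nat) (D : {set 'I_m}) (jump : 'I_m -> 'I_m) :
  (d < #|D|)%N -> signed_moves V D jump = 0.
Proof.
move=> ltdD; apply/lfunP => v; rewrite zero_lfunE; apply/eqP/negPn/negP => z0.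
have m0 : (0 < m)%N.
  rewrite -(card_ord m); apply: leq_trans (max_card D).
  exact: leq_trans ltdD.
have [N N0] := slow m0; rewrite ltnNge => /negP[].
by apply: leq_trans (signed_moves_growth N0 z0); rewrite leq_pexp2l.
Qed.

Variable U : forall n, {vspace V n}.
Hypothesis stU : stable U.

(** The full signed sum vanishes, and its terms with noninjective moves lie in
    U; hence so does the sum of the remaining terms, selected by B. *)
Lemma injective_moves_mem (m : nat) (D : {set 'I_m.+1})
    (jump : 'I_m.+1 -> 'I_m.+1) (v : V m.+1) (B : pred {set 'I_m.+1}) :
  (d < #|D|)%N -> U m = fullv ->
  (forall P : {set 'I_m.+1}, P \subset D -> ~~ B P -> exists a b, [/\ a != b &
     move_on jump P a = move_on jump P b]) ->
  \sum_(P : {set 'I_m.+1} | (P \subset D) && B P)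
    (-1) ^+ #|P| *: frep_map V (move_on jump P) v \in U m.+1.
Proof.
move=> ltdD Um ninj.
have /lfunP/(_ v) := signed_moves_eq0 jump ltdD.
rewrite zero_lfunE sum_lfunE (bigID B) /= => /eqP; rewrite addr_eq0 => /eqP.
under eq_bigr => P _ do rewrite scale_lfunE.
move=> ->; rewrite rpredN; apply: rpred_sum => P /andP[PD nBP].
have [a [b [neq_ab eq_ab]]] := ninj P PD nBP.
by rewrite scale_lfunE rpredZ // (stable_noninjective v stU Um neq_ab eq_ab).
Qed.

Lemma move_on0 (m : nat) (jump : 'I_m -> 'I_m) : move_on jump set0 = fid 'I_m.
Proof. by apply/ffunP => i; rewrite !ffunE inE. Qed.

(** Moving any position other than ord0 onto ord0 destroys injectivity, so the
    vanishing signed sum expresses v by vectors that come from V m.  Only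
    m of the m + 1 positions are movable and more than d are required, so this
    relation says nothing in degree d + 1. *)
Lemma generated_step (m : nat) :
  (d < m)%N -> U m = fullv -> U m.+1 = fullv.
Proof.
move=> ltdm Um; apply/vspaceP => v; rewrite memvf.
have cardD : #|~: [set ord0 : 'I_m.+1]| = m by rewrite cardsC1 card_ord.
have := @injective_moves_mem m (~: [set ord0]) (fun=> ord0) v
  (pred1 set0); rewrite cardD => /(_ ltdm Um).
rewrite (big_pred1 set0) => [|P]; last first.
  by rewrite /= andb_idl // => /eqP ->; exact: sub0set.
rewrite cards0 scale1r move_on0 frep_map_id id_lfunE; apply.
move=> P PD /set0Pn[i iP]; exists i, ord0; have := subsetP PD i iP.
rewrite !inE => i0; split=> //; rewrite !ffunE iP.
by case: ifP.
Qed.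

(** With a jumping to b and everything else jumping to a, a move is injective
    only if it moves nothing or exactly a and b; two terms survive in the
    vanishing signed sum, both with sign +1. *)
Lemma tperm_anti (a b : 'I_d.+1) (v : V d.+1) :
  U d = fullv -> a != b ->
  v + frep_map V (finfun (tperm a b)) v \in U d.+1.
Proof.
move=> Ud neq_ab.
pose jump i := if i == a then b else a.
have := @injective_moves_mem d setT jump v
  (fun P => (P == set0) || (P == [set a; b])).
rewrite cardsT card_ord => /(_ (leqnn _) Ud).
have ab0 : [set a; b] != set0 by apply/set0Pn; exists a; rewrite !inE eqxx.
rewrite (bigD1 set0) ?sub0set ?eqxx //=.
rewrite (big_pred1 [set a; b]) => [|P]; last first.
  rewrite subsetT /= andb_orl andbN /=.
  by rewrite andb_idr // => /eqP ->.
rewrite cards0 cards2 neq_ab sqrrN expr1n !scale1r.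
rewrite move_on0 frep_map_id id_lfunE.
have -> : move_on jump [set a; b] = finfun (tperm a b).
  apply/ffunP => i; rewrite !ffunE !inE /jump.
  by case: tpermP => [->|->|/eqP/negbTE-> /eqP/negbTE->];
    rewrite ?eqxx ?orbT // eq_sym (negbTE neq_ab).
apply=> P _; rewrite negb_or => /andP[P0 Pab].
have moveE i : move_on jump P i = if i \in P then jump i else i.
  by rewrite ffunE.
have jumpE i : i != a -> jump i = a by rewrite /jump => /negbTE ->.
have jumpa : jump a = b by rewrite /jump eqxx.
have [aP|aP] := boolP (a \in P); have [bP|bP] := boolP (b \in P).
(* A third position c in P collides with b, since both jump to a. *)
- have [c cP cab] : exists2 c, c \in P & c \notin [set a; b].
    apply/subsetPn; apply: contra Pab => Pab; rewrite eqEsubset Pab.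
    by rewrite subUset !sub1set aP bP.
  move: cab; rewrite !inE negb_or => /andP[ca cb].
  by exists c, b; split=> //; rewrite !moveE cP bP !jumpE // eq_sym.
- by exists a, b; split=> //; rewrite !moveE aP (negbTE bP).
- by exists a, b; split=> //; rewrite !moveE bP (negbTE aP) jumpE // eq_sym.
- have [c cP] := set0Pn _ P0; have ca : c != a by apply: contraTneq cP => ->.
  by exists c, a; split=> //; rewrite !moveE cP (negbTE aP) jumpE.
Qed.

Lemma perm_anti (s : 'S_d.+1) (v : V d.+1) :
  U d = fullv -> frep_map V (finfun s) v - (-1) ^+ s *: v \in U d.+1.
Proof.
move=> Ud; have [ts -> /allP dts] := prod_tpermP s.
elim: ts dts => [|[a b] ts IHts] dts.
  rewrite big_nil odd_perm1 scale1r (_ : finfun _ = fid _).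
    by rewrite frep_map_id id_lfunE subrr mem0v.
  by apply/ffunP => i; rewrite !ffunE perm1.
have neq_ab : a != b by apply: (dts (a, b)); rewrite mem_head.
rewrite big_cons odd_mul_tperm /= neq_ab.
set t := (\prod_(p <- ts) tperm p.1 p.2)%g in IHts *.
have IH : frep_map V (finfun t) v - (-1) ^+ t *: v \in U d.+1.
  by apply: IHts => p pts; apply: dts; rewrite inE pts orbT.
have -> : finfun (tperm a b * t)%g
    = fcomp (finfun t) (finfun (tperm a b)) :> {ffun 'I_d.+1 -> 'I_d.+1}.
  by apply/ffunP => i; rewrite !ffunE permM.
rewrite frep_map_comp comp_lfunE addTb signrN scaleNr opprK.
set w := frep_map V (finfun (tperm a b)) v.
have anti : v + w \in U d.+1 by apply: tperm_anti.
have -> : frep_map V (finfun t) w + (-1) ^+ t *: v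
  = frep_map V (finfun t) (v + w) - (frep_map V (finfun t) v - (-1) ^+ t *: v).
  rewrite linearD opprB [frep_map V _ v + _]addrC [_ *: v - _]addrC.
  by rewrite -addrA addNKr.
by rewrite rpredB // stU.
Qed.

End Bounded.

(** * Morphisms out of tensor powers, exterior powers and direct sums *)

Lemma image_stable (V W : frep) (eta : nat_trans W V) :
  stable (fun n => limg (eta n)).
Proof. by move=> m n f v; apply: im_closed. Qed.

(* The morphism from the k-th tensor power given by a vector of V k. *)
Section Yoneda.

Variables (V : frep) (k : nat) (v : V k).

Definition yoneda_fun (n : nat) (w : freeQ {ffun 'I_k -> 'I_n}) : V n :=
  \sum_(h : {ffun 'I_k -> 'I_n}) (w h : rat) *: frep_map V h v.

Fact yoneda_fun_linear n : linear (@yoneda_fun n).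
Proof.
move=> a x y; rewrite /yoneda_fun scaler_sumr -big_split /=.
by apply: eq_bigr => h _; rewrite !ffunE scalerDl scalerA.
Qed.

HB.instance Definition _ (n : nat) :=
  GRing.isLinear.Build rat (freeQ {ffun 'I_k -> 'I_n}) (V n) _ (@yoneda_fun n)
    (@yoneda_fun_linear n).

Definition yoneda_app (n : nat) : 'Hom(tens k n, V n) :=
  linfun (@yoneda_fun n).

Lemma yoneda_base (n : nat) (h : {ffun 'I_k -> 'I_n}) :
  yoneda_app n (freeQ_base h) = frep_map V h v.
Proof.
rewrite lfunE /= /yoneda_fun (bigD1 h) //= big1 => [|g gh].
  by rewrite ffunE eqxx scale1r addr0.
by rewrite ffunE (negbTE gh) scale0r.
Qed.

Fact yoneda_natural (m n : nat) (f : {ffun 'I_m -> 'I_n}) :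
  (yoneda_app n \o frep_map (tens k) f)%VF
    = (frep_map V f \o yoneda_app m)%VF.
Proof.
apply: freeQ_ext => h; rewrite !comp_lfunE freeQ_map_base !yoneda_base.
by rewrite frep_map_comp comp_lfunE.
Qed.

Definition yoneda : nat_trans (tens k) V := NatTrans yoneda_natural.

Lemma mem_yoneda : v \in limg (yoneda k).
Proof.
have <- : yoneda k (freeQ_base (fid 'I_k)) = v.
  by rewrite /= yoneda_base frep_map_id id_lfunE.
exact: memv_img (memvf _).
Qed.

End Yoneda.

Section Restriction.

Variables (T W V : frep) (eta : nat_trans T W) (phi : nat_trans W V).

Definition restrict_app (n : nat) : 'Hom(frep_image eta n, V n) :=
  (phi n \o linfun (@vsval rat (W n) (limg (eta n))))%VF.

Lemma restrict_appE (n : nat) (u : frep_image eta n) :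
  restrict_app n u = phi n (vsval u).
Proof. by rewrite comp_lfunE lfunE. Qed.

Fact restrict_natural (m n : nat) (f : {ffun 'I_m -> 'I_n}) :
  (restrict_app n \o frep_map (frep_image eta) f)%VF
    = (frep_map V f \o restrict_app m)%VF.
Proof.
apply/lfunP => u; rewrite [LHS]comp_lfunE [RHS]comp_lfunE !restrict_appE.
rewrite [vsval _](im_mapE f u).
by have /lfunP/(_ (vsval u)) := nt_natural phi f; rewrite !comp_lfunE.
Qed.

Definition nt_restrict : nat_trans (frep_image eta) V :=
  NatTrans restrict_natural.

(** Stated on phi (eta x) to be read for eta the antisymmetrizer: restricting
    phi to the image of eta loses nothing of what phi does after eta. *)
Lemma mem_nt_restrict (n : nat) (x : T n) :
  phi n (eta n x) \in limg (nt_restrict n).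
Proof.
have eta_x : eta n x \in limg (eta n) by rewrite memv_img ?memvf.
have <- : nt_restrict n (vsproj (limg (eta n)) (eta n x)) = phi n (eta n x).
  by rewrite [LHS]restrict_appE vsprojK.
exact: memv_img (memvf _).
Qed.

End Restriction.

Section Copairing.

Variables (A B V : frep) (p : nat_trans A V) (q : nat_trans B V).

Definition copair_fun (n : nat) (u : A n * B n) : V n := p n u.1 + q n u.2.

Fact copair_fun_linear n : linear (@copair_fun n).
Proof.
by move=> a x y; rewrite /copair_fun !linearP scalerDr addrACA.
Qed.

HB.instance Definition _ (n : nat) :=
  GRing.isLinear.Build rat (A n * B n)%type (V n) _ (@copair_fun n)
    (@copair_fun_linear n).

Definition copair_app (n : nat) : 'Hom(frep_sum A B n, V n) :=
  linfun (@copair_fun n).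

Fact copair_natural (m n : nat) (f : {ffun 'I_m -> 'I_n}) :
  (copair_app n \o frep_map (frep_sum A B) f)%VF
    = (frep_map V f \o copair_app m)%VF.
Proof.
apply/lfunP => u; rewrite !comp_lfunE !lfunE /= /copair_fun /= linearD.
have /lfunP/(_ u.1) := nt_natural p f; rewrite !comp_lfunE => ->.
by have /lfunP/(_ u.2) := nt_natural q f; rewrite !comp_lfunE => ->.
Qed.

Definition copair : nat_trans (frep_sum A B) V := NatTrans copair_natural.

Lemma limg_copair n : (limg (p n) + limg (q n) <= limg (copair n))%VS.
Proof.
rewrite subv_add; apply/andP; split; apply/subvP => _ /memv_imgP[u _ ->].
  have <- : copair n (u, 0) = p n u.
    by rewrite lfunE /= /copair_fun /= linear0 addr0.
  exact: memv_img (memvf _).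
have <- : copair n (0, u) = q n u.
  by rewrite lfunE /= /copair_fun /= linear0 add0r.
exact: memv_img (memvf _).
Qed.

End Copairing.

Fact zero_natural (A V : frep) (m n : nat) (f : {ffun 'I_m -> 'I_n}) :
  ((0 : 'Hom(A n, V n)) \o frep_map A f)%VF
    = (frep_map V f \o (0 : 'Hom(A m, V m)))%VF.
Proof. by rewrite comp_lfun0l comp_lfun0r. Qed.

Lemma bigsum_covers (V : frep) (T : eqType) (W : T -> frep)
    (phi : forall t, nat_trans (W t) V) (s : seq T) :
  exists eta : nat_trans (frep_bigsum (map W s)) V,
    forall t n, t \in s -> (limg (phi t n) <= limg (eta n))%VS.
Proof.
elim: s => [|t s [eta IHs]] /=.
  by exists (NatTrans (@zero_natural frep_zero V)).
exists (copair (phi t) eta) => u n; rewrite inE => us.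
apply: subv_trans (limg_copair (phi t) eta n).
case/orP: us => [/eqP ->|us]; first exact: addvSl.
exact: subv_trans (IHs u n us) (addvSr _ _).
Qed.

(** * Generation in low degree *)

Lemma full_of_basis (K : fieldType) (A : vectType K) (U : {vspace A}) :
  {subset vbasis (fullv : {vspace A}) <= U} -> U = fullv.
Proof.
move=> sub; apply/eqP; rewrite eqEsubv subvf /=.
rewrite -(span_basis (vbasisP (fullv : {vspace A}))).
exact/span_subvP.
Qed.

Section Generation.

Variables (V : frep) (d : nat).

Hypothesis slow : slow_growth V d.

(** Defined through the tensor power, because in this form it visibly belongs
    to the image of a morphism from the exterior power; antisymmetrizeE gives
    the usual formula. *)
Definition antisymmetrize (v : V d.+1) : V d.+1 :=
  yoneda v d.+1 (alt d.+1 d.+1 (freeQ_base (fid 'I_d.+1))).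

Lemma antisymmetrizeE v :
  antisymmetrize v
    = (d.+1`!%:R)^-1 *: \sum_(s : 'S_d.+1) (-1) ^+ s *: frep_map V (finfun s) v.
Proof.
rewrite /antisymmetrize /= scale_lfunE linearZ sum_lfunE linear_sum /=.
congr (_ *: _); apply: eq_bigr => s _.
rewrite scale_lfunE linearZ /= freeQ_map_base yoneda_base.
by congr (_ *: frep_map V _ v); apply/ffunP => i; rewrite !ffunE.
Qed.

(** Each term sign(s) s v of the antisymmetrizer is v modulo U by perm_anti,
    hence so is their average. *)
Lemma antisymmetrize_sub (U : forall n, {vspace V n}) (v : V d.+1) :
  stable U -> U d = fullv -> antisymmetrize v - v \in U d.+1.
Proof.
move=> stU Ud; have fact0 : (d.+1`!%:R : rat) != 0.
  by rewrite pnatr_eq0 -lt0n fact_gt0.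
have -> : antisymmetrize v - v = (d.+1`!%:R)^-1 *: \sum_(s : 'S_d.+1)
    (-1) ^+ s *: (frep_map V (finfun s) v - (-1) ^+ s *: v).
  rewrite antisymmetrizeE -[X in _ - X](scalerK fact0) -scalerBr.
  congr (_ *: _); under [RHS]eq_bigr => s _ do
    rewrite scalerBr scalerA -signr_addb addbb scale1r.
  rewrite sumrB sumr_const; congr (_ - _).
  by rewrite scaler_nat card_Sn.
by rewrite rpredZ // rpred_sum // => s _; rewrite rpredZ // perm_anti.
Qed.

(** Degrees up to d are given and those beyond d + 1 follow by generated_step.
    In degree d + 1 each vector differs from its antisymmetrization by an
    element of U. *)
Lemma generation (U : forall n, {vspace V n}) :
  stable U -> (forall k, (k <= d)%N -> U k = fullv) ->
  {in vbasis (fullv : {vspace V d.+1}),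
    forall v, antisymmetrize v \in U d.+1} ->
  forall n, U n = fullv.
Proof.
move=> stU Ulow Uanti; have Ud := Ulow d (leqnn d).
elim=> [|n Un]; first exact: Ulow.
have [lt_nd|lt_dn|->] := ltngtP n d; first exact: Ulow.
  exact: (generated_step slow stU lt_dn Un).
apply: full_of_basis => v vB; rewrite -[v](subKr (antisymmetrize v)).
by rewrite rpredB ?antisymmetrize_sub ?Uanti.
Qed.

End Generation.

Section Generators.

Variable V : frep.

(** Pairs of a degree and a vector: the list of summands and the list of
    morphisms to V are both obtained by mapping over one list of such pairs. *)
Definition elements : eqType := {k : nat & (V k : eqType)}.

Definition basis_elements (ks : seq nat) : seq elements :=
  [seq (Tagged (fun k => V k : eqType) v : elements)
     | k <- ks, v <- vbasis (fullv : {vspace V k})].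

Lemma mem_basis_elements (ks : seq nat) (k : nat) (v : V k) :
  k \in ks -> v \in vbasis (fullv : {vspace V k}) ->
  (Tagged (fun k => V k : eqType) v : elements) \in basis_elements ks.
Proof. by move=> kks vB; apply/allpairsPdep; exists k, v. Qed.

Lemma tags_basis_elements (ks : seq nat) (P : pred nat) :
  all P ks -> all P [seq tag t | t <- basis_elements ks].
Proof.
move=> /allP ksP; apply/allP => _ /mapP[_ /allpairsPdep[k [v [kks _ ->]] ->]].
exact: ksP.
Qed.

End Generators.

Theorem corollary5p8 (R : archiRealFieldType) (V : frep)
    (d : nat) (psi : {poly R})
    (deg_psi : size psi = d.+1)
    (dimV : forall n : nat, (\dim (fullv : {vspace V n}))%:R <= psi.[n%:R]) :
  (exists ks : seq nat,
     all (fun k => (k <= d.+1)%N) ks /\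
     is_quotient_of V (frep_bigsum [seq tens k | k <- ks])) /\
  (exists (ks : seq nat) (r : nat),
     all (fun k => (k <= d)%N) ks /\
     is_quotient_of V
       (frep_bigsum ([seq tens k | k <- ks] ++ nseq r (ext_power d.+1)))).
Proof.
have slow : slow_growth V d.
  move=> m m0; have szpsi : (size psi <= d.+1)%N by rewrite deg_psi.
  have [N N0 ltN] := poly_lt_power m0 szpsi; exists N => //.
  by rewrite -(ltr_nat R) natrX (le_lt_trans (dimV _)).
have range_le n : all (fun k => (k <= n)%N) (iota 0 n.+1).
  by apply/allP => k; rewrite mem_iota.
have upto n k : (k <= n)%N -> k \in iota 0 n.+1 by rewrite mem_iota.
split.
  pose ts := basis_elements V (iota 0 d.+2).
  exists [seq tag t | t <- ts]; split.
    exact: tags_basis_elements (range_le _).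
  rewrite -map_comp.
  have [eta cover] :=
    bigsum_covers (fun t : elements V => yoneda (tagged t)) ts.
  exists eta.
  have full k : (k <= d.+1)%N -> limg (eta k) = fullv.
    move=> /upto kle; apply: full_of_basis => v vB.
    apply: subvP (cover _ k (mem_basis_elements kle vB)) _ _.
    exact: mem_yoneda.
  apply: (generation slow (@image_stable V _ eta)) => [k kd|v _].
    exact/full/leqW.
  by rewrite full ?memvf.
pose ts := basis_elements V (iota 0 d.+1).
pose B := vbasis (fullv : {vspace V d.+1}).
exists [seq tag t | t <- ts], (size B); split.
  exact: tags_basis_elements (range_le _).
pose W (t : elements V + V d.+1) : frep :=
  match t with inl t => tens (tag t) | inr v => ext_power d.+1 end.
pose phi (t : elements V + V d.+1) : nat_trans (W t) V :=
  match t return nat_trans (W t) V with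
  | inl t => yoneda (tagged t)
  | inr v => nt_restrict (alt d.+1) (yoneda v)
  end.
pose s : seq (elements V + V d.+1) := map inl ts ++ map inr B.
have -> : [seq tens k | k <- [seq tag t | t <- ts]]
    ++ nseq (size B) (ext_power d.+1) = map W s.
  rewrite [RHS]map_cat -!map_comp; congr (_ ++ _).
  by elim: (B : seq _) => //= v B' ->.
have [eta cover] := bigsum_covers phi s; exists eta.
have full k : (k <= d)%N -> limg (eta k) = fullv.
  move=> /upto kle; apply: full_of_basis => v vB.
  have ts_s : inl (Tagged (fun k => V k : eqType) v) \in s.
    by rewrite mem_cat map_f // mem_basis_elements.
  apply: subvP (cover _ k ts_s) _ _; exact: mem_yoneda.
apply: (generation slow (@image_stable V _ eta)) => [//|v vB].
have Bs : inr v \in s by rewrite mem_cat map_f ?orbT.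
apply: subvP (cover _ d.+1 Bs) _ _; exact: mem_nt_restrict.
Qed.
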